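(* Let $d\ge2$ and let $Q^d$ be the $d$-dimensional hypercube, viewed as the Cayley graph of $\mathbb{Z}_2^d$ with the standard generators $e_1,\dots,e_d$, with two-way communication. Then: (i) $Q^d$ with the standard generators has a regular order; (ii) for $1\le l\le d$ the minimum time of a communication graph for broadcast from each vertex to all vertices within distance $l$ is $\left\lceil \frac{\sum_{i=1}^{l}\binom{d}{i}}{d}\right\rceil$; (iii) the minimum time for universal broadcast is $\left\lceil\frac{2^d-1}{d}\right\rceil$; (iv) the minimum time to communicate from each vertex to all vertices at distance $d-1$ and $d$ is $d$; (v) for $1\le s<d-1$ the minimum time to communicate from each vertex to all vertices at distance $s$ is $\binom{d-1}{s-1}$; (vi) the minimum time for universal exchange is $2^{d-1}$.
   Context: The Cayley graph has vertex set $\mathbb{Z}_2^d$ and directed edges $(g,g+e_i)$; every edge is present in both directions. For $r\ge0$ let $S_r$ be the set of vertices at distance $\le r$ from $0$, $S_{-1}=\emptyset$. A regular order is an indexing $\{\delta_1,\dots,\delta_d\}$ of the generators and $\{g_0,\dots,g_{P-1}\}$ of the group ($P=2^d$) such that (a) $g_0=0$; (b) if $g_j\in S_r$ and $i<j$ then $g_i\in S_r$; (c) for every $a\ge0$ and $1\le b\le d$ with $ad+b\le P-1$ there are pairwise distinct $\delta_{i_1},\dots,\delta_{i_b}$ such that for each $1\le c\le b$, $g_{ad+c}-\delta_{i_c}=g_{s_c}$ with $s_c\le ad$, and if $g_{ad+c}\in S_r\setminus S_{r-1}$ then $g_{s_c}\in S_{r-1}$. A task graph is a finite sequence $(e_i)$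 of directed edges labeled by positive integer times such that (1) $t(e_i)<t(e_j)$ implies $e_i<e_j$ or $e_i,e_j$ incomparable, and (2) $t(e_i)=t(e_j)$ implies $i=j$ or incomparable, where $e_i<e_j$ means there is a directed path in the task graph beginning with $e_i$ and ending with $e_j$; its time is its maximum label. A (two-way) communication graph is a collection of task graphs such that no directed edge carries a given label more than once in the collection (opposite directions of an edge may share a label); its time is the maximum time of its task graphs. Broadcast from each vertex to all vertices within distance $l$: for each $v$ a task graph containing a directed path from $v$ to every vertex at distance $1,\dots,l$ from $v$ (universal broadcast when $l=d$). Communicating from each vertex to all vertices at distances in a set $\Sigma$: for each ordered pair $(x,y)$ with $d(x,y)\in\Sigma$, a task graph which is a directed path from $x$ to $y$; universal exchange is $\Sigma=\{1,\dots,d\}$. *)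

(* Defs.v *)
From HB Require Import structures.
From mathcomp Require Import all_boot all_order all_algebra.
Set Implicit Arguments. Unset Strict Implicit. Unset Printing Implicit Defensive.
Import Order.TTheory GRing.Theory Num.Theory.
Local Open Scope ring_scope.

Definition vertex (d : nat) := 'rV['Z_2]_d.

Definition gen (d : nat) (i : 'I_d) : vertex d := delta_mx 0 i.

(* The pair (g, i) stands for the directed edge from g to g + e_i.  The opposite
   edge is (g + e_i, i), a different pair. *)
Definition arc (d : nat) := (vertex d * 'I_d)%type.
Definition src (d : nat) (a : arc d) : vertex d := a.1.
Definition tgt (d : nat) (a : arc d) : vertex d := a.1 + gen a.2.

(* The vertices visited are x :: map tgt p.  They are required to be pairwise
   distinct: a path is not a mere walk. *)
Definition dipath (d : nat) (x : vertex d) (p : seq (arc d)) (y : vertex d) :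
    bool :=
  [&& map (@src d) p == belast x (map (@tgt d) p),
      last x (map (@tgt d) p) == y
    & uniq (x :: map (@tgt d) p)].

(* The least length of a directed path from x to y.  A path has fewer than
   #|vertex d| edges, and the cube is connected, so the search succeeds. *)
Definition dist (d : nat) (x y : vertex d) : nat :=
  find (fun n => [exists p : n.-tuple (arc d), dipath x p y])
       (iota 0 #|vertex d|).

(* The radius is an integer so that ball0 d (-1) is the empty set. *)
Definition ball0 (d : nat) (r : int) : {set vertex d} :=
  [set x | (dist 0 x)%:Z <= r].

Definition regular_order (d : nat) (delta : d.-tuple (vertex d))
    (g : seq (vertex d)) : Prop :=
  [/\ perm_eq delta (codom (@gen d)) /\ perm_eq g (enum {: vertex d}),
      g`_0 = 0,
      forall (r i j : nat), (j < 2 ^ d)%N -> g`_j \in ball0 d r -> (i < j)%N ->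
        g`_i \in ball0 d r
    & forall a b : nat, (1 <= b <= d)%N -> (a * d + b <= 2 ^ d - 1)%N ->
        exists k : nat -> 'I_d,
          {in [pred c | (1 <= c <= b)%N] &, injective k} /\
          forall c : nat, (1 <= c <= b)%N ->
            exists s : nat,
              [/\ (s <= a * d)%N,
                  g`_(a * d + c)%N - tnth delta (k c) = g`_s
                & forall r : nat,
                    g`_(a * d + c)%N \in ball0 d r :\: ball0 d (r%:Z - 1) ->
                    g`_s \in ball0 d (r%:Z - 1)]].

Definition labeled_arcs (d : nat) := seq (arc d * nat).

Definition edge (d : nat) (t : labeled_arcs d) (i : 'I_(size t)) : arc d :=
  (tnth (in_tuple t) i).1.
Definition label (d : nat) (t : labeled_arcs d) (i : 'I_(size t)) : nat :=
  (tnth (in_tuple t) i).2.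

(* Relations between positions of the sequence, not between edges, since the
   same edge may occur at several positions. *)
Definition precedes (d : nat) (t : labeled_arcs d) (i j : 'I_(size t)) : Prop :=
  exists q : seq 'I_(size t),
    last i q = j /\
    dipath (src (edge i)) (map (@edge d t) (i :: q)) (tgt (edge j)).

Definition incomparable (d : nat) (t : labeled_arcs d) (i j : 'I_(size t)) :
    Prop :=
  ~ precedes i j /\ ~ precedes j i.

Definition task_graph (d : nat) (t : labeled_arcs d) : Prop :=
  [/\ forall i : 'I_(size t), (0 < label i)%N,
      forall i j : 'I_(size t), (label i < label j)%N ->
        precedes i j \/ incomparable i j
    & forall i j : 'I_(size t), label i = label j -> i = j \/ incomparable i j].

Definition task_time (d : nat) (t : labeled_arcs d) : nat :=
  (\max_(e <- t) e.2)%N.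

(* The collection is a family, so that different indices carry different task
   graphs; opposite directions of an edge are different arcs and may share a
   label. *)
Definition comm_graph (d : nat) (I : finType) (T : I -> labeled_arcs d) : Prop :=
  (forall i : I, task_graph (T i)) /\ uniq (flatten [seq T i | i : I]).

Definition comm_time (d : nat) (I : finType) (T : I -> labeled_arcs d) : nat :=
  (\max_(i : I) task_time (T i))%N.

Definition broadcast_graph (d l : nat) (T : vertex d -> labeled_arcs d) : Prop :=
  comm_graph T /\
  forall v w : vertex d, (1 <= dist v w <= l)%N ->
    exists p : seq (arc d), {subset p <= unzip1 (T v)} /\ dipath v p w.

Definition pairs_at (d : nat) (Sigma : seq nat) :=
  {xy : vertex d * vertex d | dist xy.1 xy.2 \in Sigma}.

(* perm_eq: the order in which a task graph lists its edges is irrelevant. *)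
Definition exchange_graph (d : nat) (Sigma : seq nat)
    (T : pairs_at d Sigma -> labeled_arcs d) : Prop :=
  comm_graph T /\
  forall xy : pairs_at d Sigma,
    exists p : seq (arc d),
      perm_eq p (unzip1 (T xy)) /\ dipath (val xy).1 p (val xy).2.

Definition is_minimum (A : Type) (P : A -> Prop) (f : A -> nat) (n : nat) : Prop :=
  (exists2 x, P x & f x = n) /\ forall x, P x -> (n <= f x)%N.

Definition min_broadcast_time (d l n : nat) : Prop :=
  is_minimum (@broadcast_graph d l) (@comm_time d (vertex d)) n.

Definition min_exchange_time (d : nat) (Sigma : seq nat) (n : nat) : Prop :=
  is_minimum (@exchange_graph d Sigma) (@comm_time d (pairs_at d Sigma)) n.

Definition ceil_ratio (m d : nat) : nat := `|Num.ceil (m%:R / d%:R : rat)|%N.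

(* Main.v *)
(* The distance in the cube is the Hamming weight of the difference, so every
   lower bound counts labeled edges: at each time each of the d 2^d directed
   edges is used at most once.

   For the upper bounds all task graphs are translates of those from the
   vertex 0, which makes them compatible as soon as no pair (direction, label)
   is repeated among the task graphs from 0.

   For exchange, a target is a set A of directions, which may be traversed in any
   order.  Labels are a proper edge colouring of the bipartite graph joining A to
   its elements, which exists with as many colours as the maximal degree by
   Koenig's theorem; the maximal degree is the degree of the directions.

   For broadcast, the vertices are listed layer by layer so that the vertex g_n
   contains the direction n - 1 mod d, along which it is reached at time
   ceil(n/d).  Such a listing is a concatenation of rotation orbits.  The parent
   of g_n has to lie in an earlier block of d vertices; this is ensured by
   putting the cyclic intervals first in each layer, since the parent of an
   interval is an interval.  The very last vertex is fine because d does not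
   divide 2^d - 1. *)
Require Import Defs.
From HB Require Import structures.
From mathcomp Require Import all_boot all_order all_algebra.
From mathcomp Require Import perm cyclic zify.
From Stdlib Require Import Classical_Prop.
Set Implicit Arguments. Unset Strict Implicit. Unset Printing Implicit Defensive.
(* [path.arc] would otherwise shadow [Defs.arc]. *)
Import Defs.
Import Order.TTheory GRing.Theory Num.Theory.

(** * Vertices as sets of directions, walks, and distance as Hamming weight *)

Section Cube.
Variable d : nat.
Implicit Types (u v w x y : vertex d) (i j k : 'I_d) (A B : {set 'I_d}).

Lemma Z2_cases (a : 'Z_2) : a = 0%R \/ a = 1%R.
Proof. by case: a => [[|[|//]] ?]; [left | right]; apply/val_inj. Qed.

Lemma addvv v : (v + v = 0)%R.
Proof.
apply/rowP=> i; rewrite !mxE.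
by case: (Z2_cases (v 0%R i)) => ->; apply/val_inj.
Qed.

Lemma oppv v : (- v = v)%R.
Proof. by apply/eqP; rewrite eq_sym -addr_eq0 addvv. Qed.

Definition supp v : {set 'I_d} := [set i | v 0%R i != 0%R].
Definition vec A : vertex d := (\row_i (i \in A)%:R)%R.

Lemma vecK : cancel vec supp.
Proof. by move=> A; apply/setP=> i; rewrite inE mxE; case: (i \in A). Qed.

Lemma suppK : cancel supp vec.
Proof.
move=> v; apply/rowP=> i; rewrite mxE inE.
by case: (Z2_cases (v 0%R i)) => ->; apply/val_inj.
Qed.

Lemma supp0 : supp 0%R = set0.
Proof. by apply/setP=> i; rewrite !inE mxE eqxx. Qed.

Lemma supp_gen i : supp (gen i) = [set i].
Proof. by apply/setP=> j; rewrite !inE mxE eqxx /=; case: (j == i). Qed.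

Lemma in_suppD u v i : (i \in supp (u + v)%R) = (i \in supp u) (+) (i \in supp v).
Proof.
rewrite !inE mxE.
by case: (Z2_cases (u 0%R i)) => ->; case: (Z2_cases (v 0%R i)) => ->.
Qed.

Lemma suppD_gen_in v i : i \in supp v -> supp (v + gen i)%R = supp v :\ i.
Proof.
move=> vi; apply/setP=> j; rewrite in_suppD supp_gen in_setD1 in_set1.
by case: eqP => [->|_]; rewrite ?vi ?addbF.
Qed.

Lemma card_suppD_gen v i : #|supp (v + gen i)%R| <= #|supp v|.+1.
Proof.
have sub : supp (v + gen i)%R \subset i |: supp v.
  apply/subsetP=> j; rewrite in_suppD supp_gen in_setU1 in_set1.
  by case: (_ == i); rewrite ?addbF.
apply: leq_trans (subset_leq_card sub) _.
by rewrite cardsU1; case: (i \in _).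
Qed.

Fixpoint walk x (ks : seq 'I_d) : seq (arc d) :=
  if ks is k :: ks' then (x, k) :: walk (x + gen k)%R ks' else [::].

Lemma size_walk x ks : size (walk x ks) = size ks.
Proof. by elim: ks x => //= k ks IH x; rewrite IH. Qed.

Lemma walk_tgt_coord x ks i z :
  i \notin ks -> z \in x :: map (@tgt d) (walk x ks) ->
  (i \in supp z) = (i \in supp x).
Proof.
elim: ks x => [|k ks IH] x /=; first by rewrite inE => _ /eqP->.
rewrite inE negb_or => /andP[ik iks]; rewrite inE => /orP[/eqP->//|].
by move=> /(IH _ iks) ->; rewrite in_suppD supp_gen in_set1 (negPf ik) addbF.
Qed.

Lemma dipath_consE x a p y :
  dipath x (a :: p) y =
  [&& src a == x, x \notin tgt a :: map (@tgt d) p & dipath (tgt a) p y].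
Proof.
rewrite /dipath /= eqseq_cons -!andbA; case: (src a == x) => //=.
by do 2!bool_congr.
Qed.

Lemma dipath_walk x ks :
  uniq ks -> dipath x (walk x ks) (x + \sum_(k <- ks) gen k)%R.
Proof.
elim: ks x => [|k ks IH] x; first by rewrite /dipath /= big_nil addr0 !eqxx.
case/andP=> kks uks; rewrite big_cons addrA /= dipath_consE eqxx IH // andbT.
(* Direction [k] is flipped once and never again, so coordinate [k] separates [x] from every later
   vertex. *)
apply/negP=> /(walk_tgt_coord kks).
by rewrite in_suppD supp_gen set11; case: (k \in supp x).
Qed.

Lemma in_walk x ks (a : arc d) : a \in walk x ks ->
  exists ks1 ks2, ks = ks1 ++ a.2 :: ks2 /\ a.1 = (x + \sum_(k <- ks1) gen k)%R.
Proof.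
elim: ks x => [//|k ks IH] x /=; rewrite inE => /orP[/eqP->|/IH[ks1 [ks2 [-> ->]]]].
  by exists [::], ks; rewrite big_nil addr0.
by exists (k :: ks1), ks2; rewrite big_cons addrA.
Qed.

Lemma in_supp_sum_gen ks i :
  uniq ks -> (i \in supp (\sum_(k <- ks) gen k)%R) = (i \in ks).
Proof.
elim: ks => [|k ks IH] /=; first by rewrite big_nil supp0 in_set0.
case/andP=> kks uks; rewrite big_cons in_suppD IH // supp_gen in_set1 in_cons.
by case: eqP => [->|] //; rewrite (negPf kks).
Qed.

Lemma sum_gen_enum A ks : perm_eq ks (enum A) -> (\sum_(k <- ks) gen k = vec A)%R.
Proof.
move=> pks; apply: (can_inj suppK); rewrite vecK; apply/setP=> i.
by rewrite in_supp_sum_gen ?(perm_uniq pks) ?enum_uniq // (perm_mem pks) mem_enum.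
Qed.

Lemma dipath_card x p y : dipath x p y -> #|supp (y - x)%R| <= size p.
Proof.
elim: p x => [|a p IH] x; first by case/and3P=> _ /eqP/= -> _; rewrite subrr supp0 cards0.
rewrite dipath_consE => /and3P[/eqP<- _ /IH le_p].
apply: (@leq_trans #|supp (y - tgt a)%R|.+1) => //.
suff -> : (y - src a = (y - tgt a) + gen a.2)%R by apply: card_suppD_gen.
by rewrite /tgt opprD addrA subrK.
Qed.

Lemma card_vertex : #|vertex d| = 2 ^ d.
Proof. by rewrite card_mx card_ord mul1n. Qed.

Lemma distE x y : dist x y = #|supp (y - x)%R|.
Proof.
rewrite /dist; set c := #|_|; set P := (X in find X _).
(* The search in [dist] only tries lengths below 2 ^ d; the weight [c] is at most d, hence among
   them. *)
have ltc : c < #|vertex d|.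
  rewrite card_vertex; apply: leq_ltn_trans (ltn_expl d (ltnSn 1)).
  by rewrite /c -[X in _ <= X]card_ord max_card.
have Pc : P c.
  apply/existsP; have sz : size (walk x (enum (supp (y - x)%R))) == c.
    by rewrite size_walk -cardE.
  exists (Tuple sz) => /=.
  have /= := dipath_walk x (enum_uniq (supp (y - x)%R)).
  by rewrite (sum_gen_enum (perm_refl _)) suppK [(x + _)%R]addrC subrK.
have ltf : find P (iota 0 #|vertex d|) < #|vertex d|.
  by rewrite -[X in _ < X](size_iota 0) -has_find; apply/hasP; exists c; rewrite ?mem_iota.
apply/eqP; rewrite eqn_leq; apply/andP; split.
  rewrite leqNgt; apply/negP=> /(before_find 0); rewrite nth_iota // add0n.
  by rewrite Pc.
have := nth_find 0 (_ : has P (iota 0 #|vertex d|)).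
rewrite nth_iota // add0n has_find size_iota => /(_ ltf)/existsP[p /dipath_card].
by rewrite size_tuple.
Qed.

End Cube.

(** * Edge colouring of bipartite graphs *)

Section Koenig.
Variables (J M : finType) (D : nat).
Implicit Types (E : {set J * M}) (j : J) (m : M).

Definition proper_coloring E (col : J -> M -> 'I_D) :=
  (forall j m m', (j, m) \in E -> (j, m') \in E -> col j m = col j m' -> m = m') /\
  (forall j j' m, (j, m) \in E -> (j', m) \in E -> col j m = col j' m -> j = j').

Lemma free_color (T : finType) (S : {set T}) (f : T -> 'I_D) :
  #|S| < D -> exists a, forall t, t \in S -> f t <> a.
Proof.
move=> ltS.
have /card_gt0P[a] : 0 < #|~: (f @: S)|.
  by rewrite cardsCs setCK card_ord subn_gt0 (leq_ltn_trans (leq_imset_card _ _)).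
rewrite inE => /imsetP fa; exists a => t tS ta; apply: fa.
by exists t.
Qed.

(* Kempe chains are followed in one direction only: a path from a machine
   enters jobs along edges of colour [a], hence never reaches a job missing [a]. *)
Definition kempe_step E (col : J -> M -> 'I_D) (a b : 'I_D) : rel (J + M) :=
  fun x y => match x, y with
    | inr m, inl j => ((j, m) \in E) && (col j m == a)
    | inl j, inr m => ((j, m) \in E) && (col j m == b)
    | _, _ => false
    end.

Lemma connect_last (T : finType) (r : rel T) x y :
  connect r x y -> x = y \/ exists2 z, connect r x z & r z y.
Proof.
case/connectP=> p; elim/last_ind: p => [|p z _] /=; first by move=> _ ->; left.
rewrite rcons_path last_rcons => /andP[xp rz] ->; right.
by exists (last x p) => //; apply/connectP; exists p.
Qed.

(** Let [a] be missing at [u] and [b] at [v]. Swapping [a] and [b] at the machines of [C], the part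
    reached by the alternating chain from [v], frees [a] at [v]. The chain avoids [u], so [a] stays
    free there and can colour the new edge. *)
Lemma koenig_step E (col : J -> M -> 'I_D) u v :
  proper_coloring E col -> (u, v) \notin E ->
  #|[set m | (u, m) \in E]| < D -> #|[set j | (j, v) \in E]| < D ->
  exists col', proper_coloring ((u, v) |: E) col'.
Proof.
move=> [pj pm] uvE du dv.
have [a fa] := free_color (col u) du.
have [b fb] := free_color (col^~ v) dv.
pose C := [pred x | connect (kempe_step E col a b) (inr v) x].
have C0 : C (inr v) by exact: connect0.
have stepC x y : C x -> kempe_step E col a b x y -> C y.
  by move=> Cx xy; exact: connect_trans Cx (connect1 xy).
(* In one direction the chain continues through such an edge; in the other, properness forces it to
   have entered through that edge. The start [v] meets no edge of colour [b]. *)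
have CE j m : (j, m) \in E -> (col j m == a) || (col j m == b) ->
    C (inl j) = C (inr m).
  move=> jmE /orP[] /eqP cjm; apply/idP/idP => Cx.
  - case: (connect_last Cx) => // -[[j'|m'] //= Cm' /andP[jm' /eqP cjm']].
    by rewrite -(pj _ _ _ jmE jm') ?cjm ?cjm' in Cm' *.
  - by apply: stepC Cx _; rewrite /= jmE cjm eqxx.
  - by apply: stepC Cx _; rewrite /= jmE cjm eqxx.
  - case: (connect_last Cx) => [[vm]|[[j'|m'] //= Cj' /andP[jm' /eqP cjm']]].
      by case: (fb j); rewrite ?inE vm.
    by rewrite -(pm _ _ _ jmE jm') ?cjm ?cjm' in Cj' *.
have Cu : ~~ C (inl u).
  apply/negP => /connect_last[//|[[j'|m'] //= _ /andP[um' /eqP cum']]].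
  by case: (fa m'); rewrite ?inE.
pose c1 j m := if C (inr m) then tperm a b (col j m) else col j m.
pose c2 j m := if (j, m) == (u, v) then a else c1 j m.
have ab_tperm (c : 'I_D) : c != a -> c != b -> tperm a b c = c.
  by move=> ca cb; rewrite tpermD // eq_sym.
have c1b j m : (j, m) \in E -> c1 j m = a ->
    C (inr m) /\ col j m = b \/ ~~ C (inr m) /\ col j m = a.
  rewrite /c1; case: (C (inr m)) => _ ca; [left|by right].
  by split=> //; rewrite -[col j m](tpermK a b) ca tpermL.
have c1u m : (u, m) \in E -> c1 u m <> a.
  move=> umE /(c1b _ _ umE)[[Cm cb]|[_ ca]]; last by case: (fa m); rewrite ?inE.
  by move: Cu; rewrite (CE u m) ?cb ?eqxx ?orbT // Cm.
have c1v j : (j, v) \in E -> c1 j v <> a.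
  move=> jvE /(c1b _ _ jvE)[[_ cb]|[]]; last by rewrite C0.
  by case: (fb j); rewrite ?inE.
have c1_pj j m m' : (j, m) \in E -> (j, m') \in E -> c1 j m = c1 j m' -> m = m'.
  (* By [CE] the colours [a] and [b] cannot occur here, and the swap fixes all others. *)
  have mixed n n' : (j, n) \in E -> (j, n') \in E -> C (inr n) -> ~~ C (inr n') ->
      tperm a b (col j n) = col j n' -> n = n'.
    move=> nE n'E Cn Cn' cc.
    have [cab|/norP[ca cb]] := boolP ((col j n == a) || (col j n == b)).
      have cab' : (col j n' == a) || (col j n' == b).
        by case/orP: cab cc => /eqP-> <-; rewrite ?tpermL ?tpermR eqxx ?orbT.
      by rewrite -(CE _ _ n'E cab') (CE _ _ nE cab) Cn in Cn'.
    by apply: (pj j) => //; rewrite -cc ab_tperm.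
  move=> mE m'E; rewrite /c1.
  case: ifPn => Cm; case: ifPn => Cm' cc.
  - by move/perm_inj: cc; apply: pj.
  - exact: mixed cc.
  - by apply/esym; apply: mixed (esym cc).
  - exact: pj cc.
have c1_pm j j' m : (j, m) \in E -> (j', m) \in E -> c1 j m = c1 j' m -> j = j'.
  rewrite /c1 => jE j'E; case: ifP => _; last exact: pm.
  by move/perm_inj; apply: pm.
have inE1 j m : (j, m) \in (u, v) |: E -> (j, m) <> (u, v) -> (j, m) \in E.
  by rewrite in_setU1 => /orP[/eqP|].
exists c2; split=> [j m m'|j j' m]; rewrite /c2;
  case: eqP => [[-> ->]|n1]; case: eqP => [[e1 e2]|n2] //= H1 H2.
- by move/esym; case/(c1u _ (inE1 _ _ H2 n2)).
- by rewrite {}e1 in H1 n1 *; case/(c1u _ (inE1 _ _ H1 n1)).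
- by apply: c1_pj; apply: inE1.
- by move/esym; case/(c1v _ (inE1 _ _ H2 n2)).
- by rewrite {}e2 in H1 n1 *; case/(c1v _ (inE1 _ _ H1 n1)).
- by apply: c1_pm; apply: inE1.
Qed.

Theorem koenig_edge_coloring E : 0 < D ->
  (forall j, #|[set m | (j, m) \in E]| <= D) ->
  (forall m, #|[set j | (j, m) \in E]| <= D) ->
  exists col, proper_coloring E col.
Proof.
move=> D0; have [n] := ubnP #|E|; elim: n E => // n IH E /ltnSE leE dJ dM.
have [->|/set0Pn[[u v] uvE]] := eqVneq E set0.
  by exists (fun _ _ => Ordinal D0); split=> [j m m'|j j' m]; rewrite inE.
have sub : E :\ (u, v) \subset E by apply: subD1set.
have [|||col col_proper] := IH (E :\ (u, v)).
- by rewrite (cardsD1 (u, v) E) uvE in leE.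
- move=> j; apply: leq_trans (dJ j); apply/subset_leq_card/subsetP => m.
  by rewrite !in_set => /andP[].
- move=> m; apply: leq_trans (dM m); apply/subset_leq_card/subsetP => j.
  by rewrite !in_set => /andP[].
have [|||col' col'_proper] := koenig_step (u := u) (v := v) col_proper.
- by rewrite !inE eqxx.
- apply: leq_trans (dJ u); apply/proper_card/properP; split.
    by apply/subsetP => m; rewrite !in_set => /andP[].
  by exists v; rewrite !inE ?eqxx.
- apply: leq_trans (dM v); apply/proper_card/properP; split.
    by apply/subsetP => j; rewrite !in_set => /andP[].
  by exists u; rewrite !inE ?eqxx.
by exists col'; rewrite setD1K in col'_proper.
Qed.

End Koenig.

(** * Heights, labels and counts of labelled edges *)

Section Schedules.
Variable d : nat.
Implicit Types (t : labeled_arcs d) (x y z : vertex d) (A : {set 'I_d}).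

Lemma precedes_label t (h : vertex d -> nat) (i j : 'I_(size t)) :
  (forall a n, (a, n) \in t -> h (src a) < n <= h (tgt a)) ->
  precedes i j -> i = j \/ label i < label j.
Proof.
move=> ht [q [<- {j}]].
have hE (k : 'I_(size t)) : h (src (edge k)) < label k <= h (tgt (edge k)).
  by apply: ht; rewrite -surjective_pairing mem_tnth.
move: (tgt _) (src _) => y; elim: q i => [|k q IH] i x; first by left.
rewrite /= dipath_consE => /and3P[_ _ pth]; right.
(* The height of the vertex joining the two arcs lies between their labels. *)
have lt_ik : label i < label k.
  move: pth; rewrite dipath_consE => /and3P[/eqP e _ _].
  by have /andP[_ le_i] := hE i; have := hE k; rewrite e => /andP[/(leq_ltn_trans le_i)].
by case: (IH _ _ pth) => [<- //|]; apply: ltn_trans.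
Qed.

(* A height function [h] recording the latest time at which each vertex is
   reached makes labels increase along every directed path. *)
Lemma task_graph_of_height t (h : vertex d -> nat) :
  (forall a n, (a, n) \in t -> h (src a) < n <= h (tgt a)) -> task_graph t.
Proof.
move=> ht; have prec := precedes_label ht; split=> [i|i j ij|i j ij].
- have := ht (edge i) (label i); rewrite -surjective_pairing mem_tnth.
  by case/(_ isT)/andP => /(leq_trans (ltn0Sn _)).
- have [pij|npij] := classic (precedes i j); [by left|right; split=> // pji].
  case: (prec _ _ pji) => [e|ji]; first by rewrite e ltnn in ij.
  by have := ltn_trans ij ji; rewrite ltnn.
- have [->|nij] := eqVneq i j; [by left|right].
  by split=> /prec[e|];
    [rewrite e eqxx in nij|rewrite ij ltnn|rewrite e eqxx in nij|rewrite ij ltnn].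
Qed.

Lemma uniq_flatten_map (I : eqType) (E : eqType) (s : seq I) (F : I -> seq E) :
  uniq s -> (forall i, uniq (F i)) ->
  (forall i j e, e \in F i -> e \in F j -> i = j) -> uniq (flatten (map F s)).
Proof.
move=> us uF FF; elim: s us => //= i s IH /andP[is_ us].
rewrite cat_uniq uF IH // andbT; apply/hasPn => e /flatten_mapP[j js ej].
by apply/negP => ei; rewrite (FF _ _ _ ei ej) js in is_.
Qed.

Lemma label_le_comm_time (I : finType) (T : I -> labeled_arcs d) i a n :
  (a, n) \in T i -> n <= comm_time T.
Proof.
move=> ain; apply: leq_trans (leq_bigmax i).
exact: (@leq_bigmax_seq _ _ xpredT (fun e : arc d * nat => e.2) _ ain).
Qed.

Lemma comm_time_le (I : finType) (T : I -> labeled_arcs d) D :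
  (forall i a n, (a, n) \in T i -> n <= D) -> comm_time T <= D.
Proof.
move=> leD; apply/bigmax_leqP => i _; apply/bigmax_leqP_seq => -[a n] ain _.
exact: leD ain.
Qed.

Lemma comm_graph_size (I : finType) (T : I -> labeled_arcs d) :
  comm_graph T -> \sum_i size (T i) <= 2 ^ d * d * comm_time T.
Proof.
case=> tg uf; set D := comm_time T.
pose s := [seq (a, n) | a <- enum {: arc d}, n <- iota 1 D].
have -> : \sum_i size (T i) = size (flatten [seq T i | i : I]).
  by rewrite size_flatten /shape sumnE big_map big_image.
have -> : 2 ^ d * d * D = size s.
  by rewrite size_allpairs size_iota -cardE card_prod card_vertex card_ord.
apply: uniq_leq_size uf _ => -[a n] /flatten_mapP[i _ ai].
apply/allpairsP; exists (a, n); split; rewrite ?mem_enum // mem_iota add1n ltnS.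
rewrite (label_le_comm_time ai) andbT.
have [k ek] := (tnthP (in_tuple (T i)) (a, n) ai).
by case: (tg i) => /(_ k); rewrite /label -ek.
Qed.

(** For each of the 2 ^ d starting points [x], the set [A] determines the endpoint as
    [vec A + x]. *)
Lemma sum_translates (P : pred {set 'I_d}) (F : {set 'I_d} -> nat) :
  \sum_(xy : vertex d * vertex d | P (supp (xy.2 - xy.1)%R)) F (supp (xy.2 - xy.1)%R)
  = 2 ^ d * \sum_(A | P A) F A.
Proof.
rewrite -(pair_big_dep xpredT (fun x y => P (supp (y - x)%R))
          (fun x y => F (supp (y - x)%R))) /=.
rewrite -card_vertex -sum_nat_const; apply: eq_bigr => x _.
rewrite (reindex (fun A => vec A + x)%R) /=; last first.
  exists (fun y => supp (y - x)%R) => z _; first by rewrite addrK vecK.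
  by rewrite suppK subrK.
by apply: eq_big => [A|A _]; rewrite addrK vecK.
Qed.

(** * Exchange: colours as labels *)

Section Exchange.
Variables (Sigma : seq nat) (D : nat).
Hypotheses (D_gt0 : 0 < D)
  (degE : forall i : 'I_d,
     #|[set A : {set 'I_d} | (#|A| \in Sigma) && (i \in A)]| = D)
  (cardA : forall A : {set 'I_d}, #|A| \in Sigma -> #|A| <= D).

(** Double counting of pairs (A, i) with i in A: by [degE] the sizes of the target sets sum to d *
    D, so all paths together need at least 2 ^ d * d * D labelled edges. *)
Lemma exchange_lower_bound (T : pairs_at d Sigma -> labeled_arcs d) :
  exchange_graph T -> 0 < d -> D <= comm_time T.
Proof.
case=> cg reach d0; rewrite -(@leq_pmul2l (2 ^ d * d)) ?muln_gt0 ?expn_gt0 //.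
apply: leq_trans (comm_graph_size cg).
have -> : 2 ^ d * d * D =
    \sum_(xy : pairs_at d Sigma) #|supp ((val xy).2 - (val xy).1)%R|.
  rewrite -(big_sub [pred xy : vertex d * vertex d | dist xy.1 xy.2 \in Sigma]
            (fun xy => #|supp (xy.2 - xy.1)%R|)).
  rewrite -mulnA; under eq_bigl => xy do rewrite inE distE.
  rewrite (sum_translates (fun A => #|A| \in Sigma) (fun A => #|A|)); congr (_ * _).
  under eq_bigr => A _ do rewrite -sum1_card.
  rewrite (exchange_big_dep xpredT) //= -{1}(card_ord d) -sum_nat_const.
  apply: eq_bigr => i _; rewrite sum1_card -(degE i).
  by apply: eq_card => A; rewrite !inE.
apply: leq_sum => xy _; have [p [pT /dipath_card le_p]] := reach xy.
by rewrite (perm_size pT) size_map in le_p.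
Qed.

(** Each path crosses its directions by increasing colour, and the label is the colour plus one.
    Properness at a set makes the labels of a path increase strictly; properness at a direction
    keeps different paths apart. *)
Lemma exchange_schedule :
  exists T, @exchange_graph d Sigma T /\ comm_time T <= D.
Proof.
pose E := [set jm : {set 'I_d} * 'I_d | (#|jm.1| \in Sigma) && (jm.2 \in jm.1)].
have [A|i|col [cJ cM]] := @koenig_edge_coloring _ _ D E D_gt0.
- have [inS|/negPf ninS] := boolP (#|A| \in Sigma).
    apply: leq_trans (cardA inS); apply/subset_leq_card/subsetP => i.
    by rewrite !inE /= => /andP[].
  by rewrite (_ : [set _ | _] = set0) ?cards0 //; apply/setP => i; rewrite !inE /= ninS.
- rewrite -(degE i) subset_leq_card //; apply/subsetP => A.
  by rewrite !inE.
pose ks A := sort (relpre (fun i => col A i : nat) leq) (enum A).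
have pks A : perm_eq (ks A) (enum A) by rewrite perm_sort.
have uks A : uniq (ks A) by rewrite (perm_uniq (pks A)) enum_uniq.
have mks A i : (i \in ks A) = (i \in A) by rewrite (perm_mem (pks A)) mem_enum.
pose S (xy : pairs_at d Sigma) := supp ((val xy).2 - (val xy).1)%R.
have SE xy i : i \in S xy -> (S xy, i) \in E.
  by move=> iS; rewrite inE /= iS andbT -distE; apply: (valP xy).
pose T xy : labeled_arcs d :=
  [seq (a, (col (S xy) a.2).+1) | a <- walk (val xy).1 (ks (S xy))].
have TP xy (a : arc d) n : (a, n) \in T xy -> exists ks1 ks2,
    [/\ ks (S xy) = ks1 ++ a.2 :: ks2, n = (col (S xy) a.2).+1,
        a.1 = ((val xy).1 + \sum_(k <- ks1) gen k)%R, a.2 \in S xy &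
        {in ks1, forall k, col (S xy) k < col (S xy) a.2}].
  case/mapP=> b /in_walk[ks1 [ks2 [eks ea]]] [-> ->] {a n}.
  have bS : b.2 \in S xy by rewrite -mks eks mem_cat mem_head orbT.
  exists ks1, ks2; split=> // k kks.
  have kS : k \in S xy by rewrite -mks eks mem_cat kks.
  have : sorted (relpre (fun i => col (S xy) i : nat) leq) (ks (S xy)).
    by apply: sort_sorted => ? ?; apply: leq_total.
  rewrite sorted_pairwise; last by move=> ? ? ?; apply: leq_trans.
  rewrite eks pairwise_cat => /and3P[/allrelP/(_ k b.2 kks (mem_head _ _)) /= le_kb _ _].
  rewrite ltn_neqAle le_kb andbT; apply/eqP => /val_inj /(cJ _ _ _ (SE _ _ kS) (SE _ _ bS)) kb.
  by have := uks (S xy); rewrite eks cat_uniq /= -kb kks => /and3P[].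
have walkT xy : unzip1 (T xy) = walk (val xy).1 (ks (S xy)).
  by rewrite /unzip1 -map_comp map_id.
exists T; split; last first.
  by apply: comm_time_le => xy a n /TP[ks1 [ks2 [_ -> _ _ _]]].
split; last first.
  move=> xy; exists (unzip1 (T xy)); split=> //; rewrite walkT.
  have := dipath_walk (val xy).1 (uks (S xy)).
  by rewrite (sum_gen_enum (pks _)) suppK [X in dipath _ _ X]addrC subrK.
split=> [xy|].
  (* The latest label among the directions flipped on the way to [z]. *)
  pose h z := \max_(k in supp (z - (val xy).1)%R) (col (S xy) k).+1.
  apply: (@task_graph_of_height _ h) => a n /TP[ks1 [ks2 [eks -> ea aS lt1]]].
  have u1 : uniq ks1 by have := uks (S xy); rewrite eks cat_uniq => /and3P[].
  apply/andP; split.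
    rewrite ltnS; apply/bigmax_leqP => k; rewrite /src ea addrC addKr.
    by rewrite in_supp_sum_gen // => /lt1.
  rewrite /h; apply: (leq_bigmax_cond (F := fun k => (col (S xy) k).+1)).
  have -> : (tgt a - (val xy).1 = \sum_(k <- ks1) gen k + gen a.2)%R.
    by rewrite /tgt ea addrAC [X in (X + _)%R]addrAC subrr add0r.
  rewrite in_suppD in_supp_sum_gen // supp_gen set11.
  by rewrite addbT; apply/negP => /lt1; rewrite ltnn.
apply: uniq_flatten_map => [|xy|xy xy' [a n]]; first exact: enum_uniq.
  rewrite map_inj_uniq; last by move=> a b [].
  by have /and3P[_ _] := dipath_walk (val xy).1 (uks (S xy)) => /andP[_ /map_uniq].
case/TP=> [k1 [k2 [ek -> ea aS _]]] /TP[k1' [k2' [ek' [/val_inj en] ea' aS' _]]].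
(* A shared direction and label force equal target sets, hence equal prefixes of directions before
   the arc, hence equal starting points. *)
have eS : S xy = S xy' by apply: cM (SE _ _ aS) (SE _ _ aS') en.
have ek1 : k1 = k1'.
  have idx (l1 l2 : seq 'I_d) : uniq (l1 ++ a.2 :: l2) ->
      index a.2 (l1 ++ a.2 :: l2) = size l1.
    rewrite cat_uniq /= negb_or => /and3P[_ /andP[/negPf al1 _] _].
    by rewrite index_cat al1 /= eqxx addn0.
  have e1 := idx k1 k2; have e1' := idx k1' k2'; rewrite -ek -ek' eS in e1 e1'.
  have := congr1 (take (size k1)) ek'; rewrite -eS ek take_size_cat //.
  by rewrite -e1 // e1' // take_size_cat.
have ex : (val xy).1 = (val xy').1.
  by apply: (addIr (\sum_(k <- k1) gen k)%R); rewrite -ea ea' ek1.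
apply: val_inj; rewrite [LHS]surjective_pairing [RHS]surjective_pairing -ex.
congr pair; apply: (addIr (- (val xy).1)%R); apply: (can_inj (@suppK d)).
by rewrite {2}ex.
Qed.

Theorem min_exchange_timeE : 0 < d -> min_exchange_time d Sigma D.
Proof.
move=> d0; have [T [TE leT]] := exchange_schedule; split; last first.
  by move=> T' /exchange_lower_bound; apply.
exists T => //; apply/eqP; rewrite eqn_leq leT.
exact: exchange_lower_bound.
Qed.

End Exchange.
End Schedules.

(** * Binomial counts and the ceiling *)

Lemma card_level_sets (T : finType) (f : T -> nat) (P : pred T) (s : seq nat) :
  uniq s ->
  #|[set x | (f x \in s) && P x]| = \sum_(n <- s) #|[set x | (f x == n) && P x]|.
Proof.
elim: s => [|n s IH] /=; first by rewrite big_nil (_ : [set _ | _] = set0) ?cards0.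
case/andP=> ns us; rewrite big_cons -IH // -cardsUI.
rewrite [X in _ = _ + X]eq_card0 => [|x]; last first.
  by rewrite !inE; case: eqP => // ->; rewrite (negPf ns) andbF.
by rewrite addn0; apply: eq_card => x; rewrite !inE andb_orl.
Qed.

Lemma card_draws_containing (T : finType) (i : T) (s : nat) : 0 < s ->
  #|[set A : {set T} | (#|A| == s) && (i \in A)]| = 'C(#|T|.-1, s.-1).
Proof.
move=> s0; rewrite -(cardsC1 i) -cards_draws.
have inj : {in [set B : {set T} | B \subset [set~ i] & #|B| == s.-1] &,
    injective (fun B => i |: B)}.
  have notin B : B \in [set B : {set T} | B \subset [set~ i] & #|B| == s.-1] -> i \notin B.
    by rewrite inE => /andP[/subsetP sB _]; apply/negP => /sB; rewrite !inE eqxx.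
  by move=> B B' /notin iB /notin iB' e; rewrite -(setU1K iB) e setU1K.
rewrite -(card_in_imset inj); apply: eq_card => A.
rewrite inE; apply/andP/imsetP => [[/eqP cA iA]|[B]].
  exists (A :\ i); last by rewrite setD1K.
  rewrite inE -cA (cardsD1 i A) iA eqxx andbT.
  by apply/subsetP => j; rewrite !inE => /andP[].
rewrite inE => /andP[/subsetP sB /eqP cB] ->.
rewrite setU11 cardsU1 cB (_ : i \notin B) ?add1n ?prednK ?eqxx //.
by apply/negP => /sB; rewrite !inE eqxx.
Qed.

(** With n = d - 1 and k = s - 1, a target set of size s has degree at most that of a direction. *)
Lemma ltn_bin n k : k < n -> k < 'C(n, k).
Proof.
elim: n k => [|n IH] [|k] //; rewrite ?bin0 // ltnS => kn.
rewrite binS -(addn1 k.+1) addnC leq_add ?bin_gt0 ?IH //.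
Qed.

Lemma sum_bin n : \sum_(k < n.+1) 'C(n, k) = 2 ^ n.
Proof.
by rewrite -[2]/(1 + 1) expnDn; apply: eq_bigr => k _; rewrite !exp1n !muln1.
Qed.

Lemma ceil_ratio_le m d k : 0 < d -> (ceil_ratio m d <= k) = (m <= k * d).
Proof.
move=> d0; have dR : (0 < d%:R :> rat)%R by rewrite ltr0n.
have c0 : (0 <= Num.ceil (m%:R / d%:R : rat))%R.
  by rewrite ceil_ge0 (lt_le_trans (ltrN10 _)) // divr_ge0 // ler0n.
rewrite -lez_nat /ceil_ratio gez0_abs // ceil_le_int ler_pdivrMr // pmulrn.
by rewrite -pmulrn -natrM ler_nat.
Qed.

Section DegreeCounts.
Variable d : nat.

(** A fixed direction lies in 'C(d - 1, n - 1) sets of size n, so the sum is the common degree of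
    the directions; the last hypothesis says that no set has larger degree. *)
Lemma min_exchange_time_sum (s : seq nat) (D : nat) :
  0 < d -> 0 < D -> uniq s -> all (leq 1) s ->
  \sum_(n <- s) 'C(d.-1, n.-1) = D ->
  (forall n, n \in s -> n <= d -> n <= D) ->
  min_exchange_time d s D.
Proof.
move=> d0 D0 us s1 sumD leD; apply: min_exchange_timeE => // [i|A inS].
  rewrite (card_level_sets (fun A : {set 'I_d} => #|A|) (fun A => i \in A) us) -sumD.
  rewrite big_seq [RHS]big_seq; apply: eq_bigr => n ns.
  by rewrite card_draws_containing ?card_ord //; apply: (allP s1).
by apply: leD => //; rewrite -[X in _ <= X](card_ord d) max_card.
Qed.

Lemma card_ball_without_center l :
  #|[set A : {set 'I_d} | 1 <= #|A| <= l]| = \sum_(1 <= i < l.+1) 'C(d, i).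
Proof.
have := card_level_sets (fun A : {set 'I_d} => #|A|) predT (iota_uniq 1 l).
rewrite /index_iota subSS subn0 => e; rewrite -[LHS]/(#|_|).
transitivity #|[set A : {set 'I_d} | (#|A| \in iota 1 l) && true]|.
  by apply: eq_card => A; rewrite !inE mem_iota andbT.
rewrite e; apply: eq_bigr => n _; rewrite -[d in RHS]card_ord -card_draws.
by apply: eq_card => A; rewrite !inE andbT.
Qed.

End DegreeCounts.

(** * Broadcast schedules and regular orders from a layered order *)

Section Broadcast.
Variables (d : nat) (d0 : 0 < d).
Implicit Types (v w x y z : vertex d) (A B : {set 'I_d}) (G : seq {set 'I_d}).

Definition cyc (n : nat) : 'I_d := Ordinal (ltn_pmod n d0).

(** Index 0 is left to the empty set, so the set at index [n.+1] is reached along [cyc n] at time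
    [(n %/ d).+1]. The bound in [layered_pred] says that its parent has been reached strictly before
    that time. *)
Record layered_order G : Prop := LayeredOrder {
  layered_uniq : uniq G;
  layered_mem : forall A, A \in G;
  layered_sorted : sorted (relpre (fun A => #|A|) leq) G;
  layered_bit : forall n, n.+1 < 2 ^ d -> cyc n \in nth set0 G n.+1;
  layered_pred : forall n, n.+1 < 2 ^ d ->
    index (nth set0 G n.+1 :\ cyc n) G <= n %/ d * d }.

Lemma size_layered G : layered_order G -> size G = 2 ^ d.
Proof.
case=> uG mG _ _ _; rewrite -(card_uniqP uG) -[d in RHS]card_ord -cardsT -card_powerset.
by apply: eq_card => A; rewrite mG inE subsetT.
Qed.

Lemma layered_le_card G i j : layered_order G -> i <= j -> j < 2 ^ d ->
  #|nth set0 G i| <= #|nth set0 G j|.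
Proof.
move=> oG ij jd; have sG := layered_sorted oG.
have tr : transitive (relpre (fun A => #|A|) leq) by move=> ? ? ?; apply: leq_trans.
have := sorted_leq_nth tr (fun _ => leqnn _) set0 sG.
by apply; rewrite ?inE ?size_layered // (leq_ltn_trans ij).
Qed.

Lemma nth_layered0 G : layered_order G -> nth set0 G 0 = set0.
Proof.
move=> oG; have m0 := layered_mem oG set0; apply/eqP; rewrite -cards_eq0 -leqn0.
have := layered_le_card oG (leq0n (index set0 G)).
by rewrite nth_index // cards0; apply; rewrite -(size_layered oG) index_mem.
Qed.

(** Sorting by size puts all sets up to [A] into the ball of radius [l]; dropping the empty set from
    the ball matches counting from index 0. *)
Lemma index_layered G A l : layered_order G -> #|A| <= l ->
  index A G <= #|[set B : {set 'I_d} | 1 <= #|B| <= l]|.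
Proof.
move=> oG Al; rewrite -ltnS; set N := #|_|.
have -> : N.+1 = #|[set B : {set 'I_d} | #|B| <= l]|.
  rewrite [RHS](cardsD1 set0) inE cards0 /= add1n; congr _.+1.
  by apply: eq_card => B; rewrite !inE lt0n cards_eq0.
have iA : index A G < size G by rewrite index_mem (layered_mem oG).
have <- : size (take (index A G).+1 G) = (index A G).+1 by rewrite size_takel.
rewrite -(card_uniqP (take_uniq _ (layered_uniq oG))).
apply/subset_leq_card/subsetP => B /(nthP set0)[i]; rewrite size_takel // => iA' <-.
rewrite inE nth_take //; apply: leq_trans Al.
rewrite -(nth_index set0 (layered_mem oG A)); apply: layered_le_card => //.
by rewrite -(size_layered oG).
Qed.

Lemma dipath_rcons x p (a : arc d) :
  dipath x p (src a) -> tgt a \notin x :: map (@tgt d) p ->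
  dipath x (rcons p a) (tgt a).
Proof.
elim: p x => [|b p IH] x.
  case/and3P=> _ /eqP /= -> _ ta; rewrite dipath_consE eqxx inE eq_sym.
  by rewrite inE in ta; rewrite ta /dipath /= !eqxx.
rewrite /= !dipath_consE map_rcons => /and3P[-> xp /IH pth] ta.
rewrite -rcons_cons mem_rcons inE negb_or xp andbT pth; last first.
  by apply: contra ta; rewrite [in X in _ -> X]in_cons => ->; rewrite orbT.
by rewrite andbT eq_sym; move: ta; rewrite in_cons negb_or => /andP[].
Qed.

Section Schedule.
Variables (G : seq {set 'I_d}) (oG : layered_order G) (l : nat).
Let N := #|[set B : {set 'I_d} | 1 <= #|B| <= l]|.

Let arcs v n : arc d := ((v + vec (nth set0 G n.+1 :\ cyc n))%R, cyc n).
Let T v : labeled_arcs d := [seq (arcs v n, (n %/ d).+1) | n <- iota 0 N].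

Lemma ball_size n : n < N -> n.+1 < 2 ^ d.
Proof.
move=> nN; apply: leq_ltn_trans nN _.
rewrite -[X in _ < 2 ^ X]card_ord -cardsT -card_powerset; apply/proper_card/properP; split.
  by apply/subsetP => A _; rewrite inE subsetT.
by exists set0; rewrite !inE ?subsetT // cards0.
Qed.

Lemma tgt_arcs v n : n < N -> tgt (arcs v n) = (v + vec (nth set0 G n.+1))%R.
Proof.
move=> /ball_size nd; rewrite /tgt /= -addrA; congr (_ + _)%R.
apply: (can_inj (@suppK d)); apply/setP=> i.
rewrite in_suppD supp_gen !vecK in_setD1 in_set1; case: eqP => [->|_]; last by rewrite addbF.
by rewrite (layered_bit oG nd).
Qed.

Lemma mem_schedule v a n :
  (a, n) \in T v -> exists2 m, m < N & a = arcs v m /\ n = (m %/ d).+1.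
Proof. by case/mapP=> m; rewrite mem_iota add0n => mN [-> ->]; exists m. Qed.

Lemma schedule_comm_graph : comm_graph T.
Proof.
split=> [v|].
  (* Adding [d.-1] rounds index / d up, which gives the time at which [z] is reached. *)
  pose h z := (index (supp (z - v)%R) G + d.-1) %/ d.
  have addvK A : supp (v + vec A - v)%R = A by rewrite addrC addKr vecK.
  apply: (@task_graph_of_height _ _ h) => a n /mem_schedule[m mN [-> ->]].
  rewrite tgt_arcs // /h /src /= !addvK ltnS index_uniq ?layered_uniq //; last first.
    by rewrite size_layered // ball_size.
  have -> : (m.+1 + d.-1) %/ d = (m %/ d).+1.
    by rewrite addSnnS prednK // divnDr ?dvdnn // divnn d0 addn1.
  rewrite leqnn andbT.
  rewrite -ltnS ltn_divLR // mulSn -ltnS -[X in _ < X]addnS addnC -addSn prednK //.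
  by rewrite ltn_add2l ltnS (layered_pred oG) ?ball_size.
apply: uniq_flatten_map => [|v|v v' [a n]]; first exact: enum_uniq.
  rewrite map_inj_in_uniq ?iota_uniq // => m m' _ _ [_ em ed].
  by rewrite (divn_eq m d) (divn_eq m' d) em ed.
(* Direction and label give the remainder and the quotient of [m] by d, so they determine [m]; then
   the source determines [v]. *)
case/mem_schedule=> m _ [-> ->] /mem_schedule[m' _ [[ev em] [ed]]].
have e : m = m' by rewrite (divn_eq m d) (divn_eq m' d) em ed.
by move: ev; rewrite -e => /addIr.
Qed.

(** Induction on [#|A|] through the parent of [A]. The distance bound is carried along to show that
    the appended endpoint, one step farther out, is new to the path. *)
Lemma schedule_reaches v A : #|A| <= l -> exists p,
  [/\ {subset p <= unzip1 (T v)}, dipath v p (v + vec A)%R &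
      {in v :: map (@tgt d) p, forall z, #|supp (z - v)%R| <= #|A|}].
Proof.
have addvK B : supp (v + vec B - v)%R = B by rewrite addrC addKr vecK.
move cA: #|A| => r; elim: r A cA => [|r IH] A cA Al.
  have /eqP-> : A == set0 by rewrite -cards_eq0 cA.
  exists [::]; rewrite /dipath /= -supp0 suppK addr0 eqxx; split=> // z.
  by rewrite inE => /eqP->; rewrite subrr supp0 cards0.
case iA: (index A G) => [|n].
  have := nth_index set0 (layered_mem oG A); rewrite iA nth_layered0 // => A0.
  by rewrite -A0 cards0 in cA.
have nN : n < N by rewrite -iA index_layered ?cA.
have GnA : nth set0 G n.+1 = A by rewrite -iA nth_index ?(layered_mem oG).
have cycA : cyc n \in A by rewrite -GnA (layered_bit oG) ?ball_size.
have cA' : #|A :\ cyc n| = r by move: cA; rewrite (cardsD1 (cyc n)) cycA => -[].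
have [p [pT pth lep]] := IH _ cA' (ltnW Al).
have tA : tgt (arcs v n) = (v + vec A)%R by rewrite tgt_arcs // GnA.
exists (rcons p (arcs v n)); split.
- move=> a; rewrite mem_rcons inE => /orP[/eqP->|/pT //].
  by apply/mapP; exists (arcs v n, (n %/ d).+1) => //; apply: map_f; rewrite mem_iota.
- rewrite -tA; apply: dipath_rcons; first by rewrite /src /= GnA.
  by apply/negP => /lep; rewrite tA addvK cA ltnn.
- move=> z; rewrite map_rcons -rcons_cons mem_rcons inE => /orP[/eqP->|/lep/leqW//].
  by rewrite tA addvK cA.
Qed.

Lemma schedule_broadcast : broadcast_graph l T.
Proof.
split; first exact: schedule_comm_graph.
move=> v w; rewrite distE => /andP[_ /(schedule_reaches v)[p [pT pth _]]].
by exists p; split=> //; rewrite suppK addrC subrK in pth.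
Qed.

Lemma schedule_time c : N <= c * d -> comm_time T <= c.
Proof.
move=> Nc; apply: comm_time_le => v a n /mem_schedule[m mN [_ ->]].
by rewrite ltn_divLR // (leq_trans mN).
Qed.

(** Every vertex of the punctured ball around [v] is the target of some arc of [T' v], so each of
    the 2 ^ d task graphs has at least [N] entries. *)
Lemma broadcast_lower_bound (T' : vertex d -> labeled_arcs d) :
  broadcast_graph l T' -> N <= comm_time T' * d.
Proof.
case=> cg reach; have := comm_graph_size cg.
rewrite -mulnA [d * _]mulnC => le_sum; rewrite -(@leq_pmul2l (2 ^ d)) ?expn_gt0 //.
apply: leq_trans le_sum; rewrite -card_vertex -sum_nat_const.
apply: leq_sum => v _; rewrite -(size_map (fun e => tgt e.1)).
pose S := [set w : vertex d | 1 <= #|supp (w - v)%R| <= l].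
have -> : N = #|S|.
  have inj : injective (fun A => v + vec A)%R.
    by move=> A B /addrI /(can_inj (@vecK d)).
  rewrite /N -(card_imset _ inj); apply: eq_card => w; rewrite inE.
  apply/imsetP/idP => [[A]|wv]; first by rewrite inE => lA ->; rewrite addrC addKr vecK.
  by exists (supp (w - v)%R); rewrite ?inE // suppK addrC subrK.
rewrite cardE; apply: uniq_leq_size (enum_uniq _) _ => w.
rewrite mem_enum inE -distE => vw; have [p [pT pth]] := reach v w vw.
have : w \in map (@tgt d) p.
  case: p pth {pT} => [/dipath_card|a p]; first by rewrite -distE; case: (dist v w) vw.
  by case/and3P=> _ /eqP /= <- _; rewrite mem_last.
case/mapP=> a /pT /mapP[e eT ea] ->; apply/mapP; exists e => //.
by rewrite ea.
Qed.

End Schedule.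

Theorem layered_min_broadcast_time G l : layered_order G ->
  min_broadcast_time d l (ceil_ratio (\sum_(1 <= i < l.+1) 'C(d, i)) d).
Proof.
move=> oG; rewrite -card_ball_without_center; set N := #|_|; set c := ceil_ratio _ _.
have lower (T : vertex d -> labeled_arcs d) : broadcast_graph l T -> c <= comm_time T.
  by move=> TB; rewrite /c ceil_ratio_le //; apply: broadcast_lower_bound TB.
split=> //; have TB := schedule_broadcast oG l.
eexists; first exact: TB.
apply/eqP; rewrite eqn_leq lower // andbT; apply: schedule_time => //.
by rewrite -ceil_ratio_le.
Qed.

Lemma layered_regular_order G : layered_order G ->
  regular_order [tuple gen i | i < d] (map (@vec d) G).
Proof.
move=> oG; have sG := size_layered oG.
have nthG i : i < 2 ^ d -> ((map (@vec d) G)`_i = vec (nth set0 G i))%R.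
  by move=> id; rewrite (nth_map set0) // sG.
have in_ball i (r : int) : i < 2 ^ d ->
    ((map (@vec d) G)`_i \in ball0 d r)%R = (#|nth set0 G i|%:Z <= r)%R.
  by move=> id; rewrite inE distE nthG // subr0 vecK.
split.
- split.
    by rewrite /codom /image_mem /= perm_refl.
  apply: uniq_perm => [||v]; rewrite ?enum_uniq //.
    by rewrite (map_inj_uniq (can_inj (@vecK d))) (layered_uniq oG).
  by rewrite mem_enum -[v](@suppK d) map_f // (layered_mem oG).
- rewrite nthG ?expn_gt0 // nth_layered0 //; apply: (can_inj (@suppK d)).
  by rewrite vecK supp0.
- move=> r i j jd jr ij; have id := ltn_trans ij jd.
  move: jr; rewrite !in_ball // => /(le_trans _); apply.
  by rewrite lez_nat layered_le_card // ltnW.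
move=> a b /andP[b0 bd] abd.
(* Position a * d + c is [n.+1] for n = a * d + c - 1, whose residue is c - 1. *)
exists (fun c => cyc c.-1); split.
  move=> c c' /andP[c0 cb] /andP[c'0 c'b] /(congr1 val) /=.
  rewrite !modn_small ?prednK ?(leq_trans _ bd) // => e.
  by rewrite -(prednK c0) -(prednK c'0) e.
move=> c /andP[c0 cb]; set n := a * d + c.-1.
have en : a * d + c = n.+1 by rewrite /n -addnS prednK.
have cd : c.-1 < d by rewrite prednK // (leq_trans cb).
have nd : n.+1 < 2 ^ d.
  rewrite -en -[2 ^ d]prednK ?expn_gt0 // ltnS -subn1.
  by apply: leq_trans abd; rewrite leq_add2l.
have cycE : cyc c.-1 = cyc n by apply/val_inj; rewrite /= modnMDl.
have divE : n %/ d = a by rewrite divnMDl // divn_small // addn0.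
set A := nth set0 G n.+1; have AG := layered_mem oG (A :\ cyc n).
have cycA := layered_bit oG nd.
exists (index (A :\ cyc n) G); split.
- by have := layered_pred oG nd; rewrite divE.
- rewrite en nthG // tnth_mktuple cycE nthG; last by rewrite -sG index_mem.
  rewrite nth_index // oppv; apply: (can_inj (@suppK d)).
  by rewrite suppD_gen_in !vecK.
move=> r; rewrite en in_setD !in_ball // => [/andP[_ Ar]|]; last by rewrite -sG index_mem.
have cA : #|A| = #|A :\ cyc n|.+1 by rewrite (cardsD1 (cyc n)) cycA add1n.
by rewrite nth_index // lerBrDr addrC -intS -cA.
Qed.

End Broadcast.

(** Let p be the least prime factor of d. Modulo p both 2 ^ d and 2 ^ (p - 1) would be 1; as d and p
    - 1 are coprime by minimality of p, this gives 2 = 1 modulo p. *)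
Lemma ndvdn_exp2_subn1 d : 1 < d -> ~~ (d %| 2 ^ d - 1).
Proof.
move=> d1; apply/negP => dvd; set p := pdiv d.
have pr_p : prime p by exact: pdiv_prime.
have pd : p %| d by exact: pdiv_dvd.
have exp_d : 2 ^ d = 1 %[mod p].
  by apply/eqP; rewrite eqn_mod_dvd ?expn_gt0 // (dvdn_trans pd).
have co2 : coprime 2 p.
  rewrite -(@coprime_pexpl d) ?(ltnW d1) // -coprime_modl exp_d coprime_modl.
  by rewrite coprime1n.
have exp_p : 2 ^ p.-1 = 1 %[mod p].
  by rewrite -totient_prime // Euler_exp_totient.
have co : gcdn d p.-1 = 1.
  apply/eqP; rewrite eqn_leq gcdn_gt0 (ltnW d1) andbT leqNgt; apply/negP => g1.
  have le_pg : p <= gcdn d p.-1 by apply: pdiv_min_dvd; rewrite ?dvdn_gcdl.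
  have p1 := prime_gt1 pr_p.
  have : gcdn d p.-1 <= p.-1 by rewrite dvdn_leq ?dvdn_gcdr //; lia.
  lia.
have p1 : 0 < p.-1 by have := prime_gt1 pr_p; lia.
have [a _ /dvdnP[b]] := Bezoutr d p1; rewrite co => eab.
have : 2 ^ (1 + a * d) = 1 %[mod p].
  by rewrite eab mulnC expnM -modnXm exp_p modnXm exp1n.
rewrite expnD mulnC [a * d]mulnC expnM -modnMml -modnXm exp_d modnXm exp1n modnMml mul1n.
move/eqP; rewrite eqn_mod_dvd // => /dvdn_leq => /(_ isT).
by have := prime_gt1 pr_p; lia.
Qed.

(** Pascal's rule from n = 5, where both values are 10. Since 'C(4, 2) = 6 is too small,
    [layered_order_exists] treats dimension 4 apart. *)
Lemma bin_ge_double n k : 4 < n -> 1 < k -> k + 1 < n -> 2 * n - 1 <= 'C(n, k).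
Proof.
elim: n k => // n IH [//|k]; rewrite ltnS leq_eqVlt => /orP[/eqP<-|n4] k1 kn.
  by case: k k1 kn => [|[|[|[|]]]].
rewrite binS; have [kn'|kn'] := ltnP (k.+1 + 1) n.
  have := IH k.+1 n4 k1 kn'; have := ltn_bin (_ : k < n); lia.
have -> : k.+1 = n.-1 by lia.
have -> : 'C(n, n.-1) = n by rewrite -bin_sub ?leq_pred // (_ : n - n.-1 = 1) ?bin1; lia.
have := IH k n4; lia.
Qed.

(** * Rotation orbits, cyclic intervals and the listing by layers *)

Section CyclicOrder.
Variables (d : nat) (d0 : 0 < d).
Implicit Types (A B : {set 'I_d}) (F : {set {set 'I_d}}) (G : seq {set 'I_d}).
Local Notation cyc := (cyc d0).

Lemma cyc_eq m n : (cyc m == cyc n) = (m == n %[mod d]).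
Proof. by rewrite -val_eqE. Qed.

Lemma cyc_ord (i : 'I_d) : cyc i = i.
Proof. by apply/val_inj; rewrite /= modn_small. Qed.

Lemma ordS_cyc n : ordS (cyc n) = cyc n.+1.
Proof. by apply/val_inj; rewrite /= -addn1 modnDml addn1. Qed.

Definition rotset A : {set 'I_d} := [set ordS i | i in A].

Lemma rotset_inj : injective rotset.
Proof. by apply: imset_inj; apply: ordS_inj. Qed.

Lemma card_rotset A : #|rotset A| = #|A|.
Proof. by rewrite card_imset //; apply: ordS_inj. Qed.

Lemma cyc_iter_rotset A n k : cyc n \in A -> cyc (n + k) \in iter k rotset A.
Proof.
move=> nA; elim: k => [|k IH]; first by rewrite addn0.
by rewrite addnS iterS -ordS_cyc imset_f.
Qed.

(* A rotation orbit can be listed so that the k-th set contains the k-th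
   element of a given run of consecutive residues: start from a set containing
   the first residue and keep rotating.  Concatenating orbits keeps this. *)
Lemma rotation_listing F p :
  (forall A, A \in F -> A != set0) -> (forall A, A \in F -> rotset A \in F) ->
  exists s, [/\ uniq s, s =i F &
                forall j, j < size s -> cyc (p + j) \in nth set0 s j].
Proof.
have [n] := ubnP #|F|; elim: n F p => // n IH F p /ltnSE leF nz rotF.
have [->|/set0Pn[A AF]] := eqVneq F set0.
  by exists [::]; split=> // A; rewrite inE.
have /set0Pn[i iA] := nz A AF.
have iterF k : iter k rotset A \in F by elim: k => //= k; apply: rotF.
(* These rotations carry [i] to the residue of [p]; adding d keeps the subtraction from
   truncating. *)
set B := iter (p + d - i) rotset A.
have pB : cyc p \in B.
  have := cyc_iter_rotset (p + d - i) (_ : cyc i \in A); rewrite cyc_ord => /(_ iA).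
  rewrite subnKC; last by rewrite (leq_trans (ltnW (ltn_ord i))) ?leq_addl.
  by rewrite (_ : cyc (p + d) = cyc p) //; apply/eqP; rewrite cyc_eq modnDr.
pose o := orbit rotset B.
have oF C : C \in o -> C \in F.
  by case/trajectP => k _ ->; rewrite /B -iterD iterF.
have [|A' /setDP[A'F _]|A' /setDP[A'F A'o]|s [us sF bs]] :=
  IH (F :\: [set C in o]) (p + size o).
- apply: leq_trans leF; apply/proper_card/properP; split; first by rewrite subsetDl.
  by exists B; rewrite ?iterF // !inE in_orbit.
- exact: nz.
- apply/setDP; split; first exact: rotF.
  move: A'o; rewrite !inE -!fconnect_orbit.
  by rewrite -(same_fconnect1_r rotset_inj).
exists (o ++ s); split.
- rewrite cat_uniq orbit_uniq us andbT; apply/hasPn => C.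
  by rewrite sF => /setDP[_]; rewrite inE.
- move=> C; rewrite mem_cat sF in_setD inE.
  by have := oF C; case: (C \in o) => // ->.
move=> j; rewrite size_cat nth_cat; case: (ltnP j (size o)) => [jo _|oj jos].
  have -> : nth set0 o j = iter j rotset B.
    by rewrite (set_nth_default B) // (nth_traject rotset) -?size_orbit.
  exact: cyc_iter_rotset.
have := bs (j - size o); rewrite -addnA subnKC //; apply.
by rewrite ltn_subLR.
Qed.

Definition cyc_arc (p r : nat) : {set 'I_d} := [set cyc (p + k) | k : 'I_r].

Lemma cyc_arcP p r i :
  reflect (exists2 k, k < r & i = cyc (p + k)) (i \in cyc_arc p r).
Proof.
apply: (iffP imsetP) => [[k _ ->]|[k kr ->]]; first by exists k.
by exists (Ordinal kr).
Qed.

Lemma cyc_addl_inj p k k' : k < d -> k' < d -> cyc (p + k) = cyc (p + k') -> k = k'.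
Proof. by move=> kd k'd /eqP; rewrite cyc_eq eqn_modDl !modn_small // => /eqP. Qed.

Lemma card_cyc_arc p r : r <= d -> #|cyc_arc p r| = r.
Proof.
move=> rd; rewrite card_imset ?card_ord // => k k' e; apply/val_inj.
by apply: cyc_addl_inj e; apply: leq_trans (ltn_ord _) rd.
Qed.

Lemma cyc_arc_mod p p' r : p = p' %[mod d] -> cyc_arc p r = cyc_arc p' r.
Proof.
move=> pp; apply: eq_imset => k; apply/eqP.
by rewrite cyc_eq -modnDml pp modnDml.
Qed.

Lemma rotset_cyc_arc p r : rotset (cyc_arc p r) = cyc_arc p.+1 r.
Proof. by rewrite /rotset -imset_comp; apply: eq_imset => k /=; rewrite ordS_cyc. Qed.

Lemma cyc_arcD1 p r : r < d -> cyc_arc p r.+1 :\ cyc p = cyc_arc p.+1 r.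
Proof.
move=> rd; apply/eqP; rewrite eqEsubset; apply/andP; split; apply/subsetP => i.
  case/setD1P=> ip /cyc_arcP[[|k] kr e]; first by rewrite e addn0 eqxx in ip.
  by apply/cyc_arcP; exists k; rewrite // addSnnS.
case/cyc_arcP=> k kr ->; apply/setD1P; split; last first.
  by apply/cyc_arcP; exists k.+1; rewrite // addSnnS.
apply/eqP; rewrite addSnnS -{2}[p]addn0 => /cyc_addl_inj e.
by have := e (leq_ltn_trans kr rd) d0.
Qed.

(* The first residue of a proper arc is its only element whose predecessor is
   not in the arc. *)
Lemma cyc_arc_inj p p' r : 0 < r < d -> cyc_arc p r = cyc_arc p' r -> p = p' %[mod d].
Proof.
case/andP=> r0 rd e.
have : cyc (p' + 0) \in cyc_arc p r by rewrite e; apply/cyc_arcP; exists 0.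
case/cyc_arcP=> -[|k] kr /eqP; rewrite cyc_eq ?addn0; first by move/eqP.
move=> e1; have : cyc (p + k) \in cyc_arc p' r.
  by rewrite -e; apply/cyc_arcP; exists k; rewrite // ltnW.
case/cyc_arcP=> k' k'r /eqP; rewrite cyc_eq => e2.
have : (p' + d.-1 == p' + k' %[mod d]).
  rewrite -(eqP e2) -(eqn_modDr 1) -addnA addn1 prednK // modnDr (eqP e1).
  by rewrite addnS addn1.
have k'd : k' < d := ltn_trans k'r rd.
rewrite eqn_modDl (modn_small k'd) modn_small ?prednK // => /eqP ek.
by have := leq_ltn_trans k'r rd; rewrite -ek prednK ?ltnn.
Qed.

(** The d intervals come first, ordered by starting point from [p]. The other sets of the layer are
    closed under rotation, so [rotation_listing] continues the run of residues from [p + d]. The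
    full set is treated apart, since its d intervals coincide. *)
Lemma layer_listing p r : 0 < r <= d ->
  exists s, [/\ uniq s, (forall A, (A \in s) = (#|A| == r)) &
    forall j, j < size s -> [/\ cyc (p + j) \in nth set0 s j,
      j < d -> nth set0 s j = cyc_arc (p + j) r &
      forall q, nth set0 s j = cyc_arc q r -> j < d]].
Proof.
case/andP=> r0; rewrite leq_eqVlt => /orP[/eqP->|rd].
  exists [:: setT]; split=> // [A|[|//] _].
    rewrite inE eqEcard subsetT cardsT card_ord /= eqn_leq.
    by rewrite -[X in #|A| <= X]card_ord max_card.
  split=> //= [|_]; first by rewrite inE.
  apply/esym/eqP; rewrite eqEcard subsetT cardsT card_ord /=.
  by rewrite card_cyc_arc.
pose arcs := mkseq (fun j => cyc_arc (p + j) r) d.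
have size_arcs : size arcs = d by rewrite size_mkseq.
have nth_arcs j : j < d -> nth set0 arcs j = cyc_arc (p + j) r by apply: nth_mkseq.
have arcsP A : reflect (exists q, A = cyc_arc q r) (A \in arcs).
  apply: (iffP idP) => [/(nthP set0)[j]|[q ->]].
    by rewrite size_arcs => jd <-; exists (p + j); rewrite nth_arcs.
  pose j := (q + (d - p %% d)) %% d; have jd : j < d by rewrite ltn_pmod.
  apply/(nthP set0); exists j; rewrite ?size_arcs // nth_arcs //.
  apply: cyc_arc_mod; rewrite modnDmr addnCA -modnDmr -[(p + _) %% d]modnDml.
  by rewrite subnKC ?modnn ?addn0 // ltnW ?ltn_pmod.
have uniq_arcs : uniq arcs.
  apply/(mkseq_uniqP _ _) => j j'; rewrite !inE => jd j'd /cyc_arc_inj.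
  by rewrite r0 rd => /(_ isT) /eqP; rewrite eqn_modDl !modn_small // => /eqP.
pose F := [set A : {set 'I_d} | #|A| == r] :\: [set A in arcs].
have [A|A|s [us sF bs]] := @rotation_listing F (p + d).
- by rewrite 3!inE => /andP[_ /eqP cA]; rewrite -card_gt0 cA.
- rewrite !inE card_rotset => /andP[nA ->]; rewrite andbT; apply: contra nA.
  case/arcsP=> q e; apply/arcsP; exists (q + d.-1); apply: rotset_inj.
  by rewrite e rotset_cyc_arc -addnS prednK //; apply: cyc_arc_mod; rewrite modnDr.
exists (arcs ++ s); split.
- rewrite cat_uniq uniq_arcs us andbT; apply/hasPn => A.
  by rewrite sF !inE => /andP[].
- move=> A; rewrite mem_cat sF !inE; case: arcsP => //= -[q ->].
  by rewrite card_cyc_arc ?eqxx // ltnW.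
move=> j; rewrite size_cat size_arcs nth_cat size_arcs; case: (ltnP j d) => [jd _|dj js].
  rewrite nth_arcs //; split=> //; apply/cyc_arcP; exists 0; rewrite ?addn0 //.
have js' : j - d < size s by rewrite ltn_subLR.
split=> //; first by have := bs _ js'; rewrite -addnA subnKC.
move=> q e; have := mem_nth set0 js'; rewrite sF !inE => /andP[/arcsP[]].
by exists q.
Qed.

(** For 1 <= r <= d this is the least [n] for which the set at index [n.+1] has r elements. *)
Definition layer_start r := \sum_(1 <= i < r) 'C(d, i).

Lemma layer_startS r : 0 < r -> layer_start r.+1 = layer_start r + 'C(d, r).
Proof. by move=> r0; rewrite /layer_start big_nat_recr. Qed.

(** In place of the parent condition this records where the intervals sit in each layer, a form that
    extends layer by layer and from which the parent condition is derived afterwards. *)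
Definition layered_upto R G :=
  [/\ uniq G, (forall A, (A \in G) = (#|A| <= R)),
      sorted (relpre (fun A => #|A|) leq) G /\ nth set0 G 0 = set0,
      size G = (layer_start R.+1).+1 &
      forall n, n.+1 < size G -> let A := nth set0 G n.+1 in
      [/\ cyc n \in A, layer_start #|A| <= n < layer_start #|A|.+1,
          n < layer_start #|A| + d -> A = cyc_arc n #|A| &
          forall q, A = cyc_arc q #|A| -> n < layer_start #|A| + d]].

Lemma layered_upto_exists R : R <= d -> exists G, layered_upto R G.
Proof.
elim: R => [_|R IH Rd].
  exists [:: set0]; split=> //; last by rewrite /layer_start big_geq.
  by move=> A; rewrite inE leqn0 cards_eq0.
have [G [uG mG [sG G0] szG nG]] := IH (ltnW Rd).
(* Starting the run at the first [n] of the new layer continues the residues without a break. *)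
have [s [us ms ns]] := @layer_listing (layer_start R.+1) R.+1 Rd.
have sz_s : size s = 'C(d, R.+1).
  rewrite -(card_uniqP us) -[d in RHS]card_ord -card_draws.
  by apply: eq_card => A; rewrite ms inE.
exists (G ++ s); split.
- rewrite cat_uniq uG us andbT; apply/hasPn => A.
  by rewrite ms mG => /eqP->; rewrite ltnn.
- by move=> A; rewrite mem_cat mG ms [RHS]leq_eqVlt orbC ltnS.
- split; last by rewrite nth_cat szG.
  have tr : transitive (relpre (fun A => #|A|) leq) by move=> ? ? ?; apply: leq_trans.
  move: sG; rewrite !(sorted_pairwise tr) pairwise_cat => ->; rewrite andTb.
  apply/andP; split.
    apply/allrelP => A B; rewrite mG ms /= => /leqW le /eqP->.
    exact: le.
  apply/(pairwiseP set0) => i j /(mem_nth set0) + /(mem_nth set0) + _ /=.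
  by rewrite !ms => /eqP-> /eqP->.
- by rewrite size_cat sz_s szG (layer_startS (ltn0Sn R)).
move=> n; rewrite nth_cat size_cat.
case: (ltnP n.+1 (size G)) => [nG' _|Gn nGs]; first exact: nG.
rewrite szG ltnS in Gn; have ns' : n - layer_start R.+1 < size s.
  by rewrite ltn_subLR // -ltnS -addSn -szG.
have -> : n.+1 - size G = n - layer_start R.+1 by rewrite szG.
have /eqP cA : #|nth set0 s (n - layer_start R.+1)| == R.+1 by rewrite -ms mem_nth.
have [] := ns _ ns'; rewrite subnKC // => b1 b2 b3 A.
rewrite /A cA; split=> //.
- by rewrite Gn (layer_startS (ltn0Sn R)); rewrite sz_s in ns'; lia.
- by move=> nd; apply: b2; lia.
- by move=> q /b3; lia.
Qed.

End CyclicOrder.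

(** The parent [B] of an interval [A] at index [n.+1] is an interval at some index [m.+1] with m = n
    + 1 modulo d. It lies early enough unless [n] ends a block and m + d = n + 1; counting layers
    excludes this, except for the full set, where divisibility does. *)
Theorem layered_order_exists d (d0 : 0 < d) : 1 < d -> exists G, layered_order d0 G.
Proof.
move=> d1; have [G [uG mG [sG G0] szG nG]] := layered_upto_exists d0 (leqnn d).
have mG' A : A \in G by rewrite mG -[X in _ <= X](card_ord d) max_card.
have sz : size G = 2 ^ d.
  rewrite -(card_uniqP uG) -[d in RHS]card_ord -cardsT -card_powerset.
  by apply: eq_card => A; rewrite mG' inE subsetT.
exists G; split=> // n; rewrite -sz => nd; first by have [] := nG n nd.
have [nA /andP[Ln nL] arcA _] := nG n nd; move: (nth _ _ _) nA Ln nL arcA => A nA Ln nL arcA.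
set B := A :\ cyc d0 n; have cA : #|A| = #|B|.+1 by rewrite (cardsD1 (cyc d0 n)) nA.
have cAd : #|A| <= d by rewrite -[X in _ <= X](card_ord d) max_card.
rewrite {}cA in Ln nL arcA cAd *.
have iB : index B G < size G by rewrite index_mem.
have nB := nth_index set0 (mG' B).
case im: (index B G) => [//|m]; rewrite im in iB nB.
have := nG m iB; rewrite nB => -[_ /andP[Lm mL] arcB1 arcB2].
have B0 : 0 < #|B|.
  rewrite card_gt0; apply/eqP => e; have := index_uniq set0 (ltn_trans (ltn0Sn m) iB) uG.
  by rewrite G0 -e im.
move: (#|B|) B0 Ln nL arcA cAd Lm mL arcB1 arcB2 => r r0 Ln nL arcA rd Lm mL arcB1 arcB2.
have nE := divn_eq n d; have n_mod := ltn_pmod n d0.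
(* Beyond the intervals, [m] is below [layer_start d r.+1], which is at most n - d. *)
have [far|near] := leqP (layer_start d r.+1 + d) n; first by lia.
have BE : B = cyc_arc d0 n.+1 r by rewrite /B (arcA near) cyc_arcD1.
have m_near := arcB2 _ BE.
have mn : m = n.+1 %[mod d].
  by apply: (@cyc_arc_inj _ d0 _ _ r); rewrite ?r0 // -BE -arcB1.
have mE := divn_eq m d; have m_mod := ltn_pmod m d0.
(* If [n] does not end its block, [m] has a larger residue than [n] but is smaller, so its quotient
   is smaller. *)
have [last_mod|not_last] := eqVneq (n %% d) d.-1; last first.
  have n1 : n.+1 %% d = (n %% d).+1.
    by rewrite -addn1 -modnDml addn1 modn_small //; lia.
  have : m %/ d * d < n %/ d * d by lia.
  rewrite ltn_pmul2r // => lt_div.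
  have : (m %/ d).+1 * d <= n %/ d * d by rewrite leq_pmul2r.
  by rewrite mulSn; lia.
have n1 : n.+1 = (n %/ d).+1 * d by rewrite mulSn; lia.
have m0 : m %% d = 0 by rewrite mn n1 modnMl.
have [e|ne] := eqVneq (m %/ d) (n %/ d); last first.
  have : m %/ d * d < (n %/ d).+1 * d by rewrite -n1; lia.
  rewrite ltn_pmul2r // ltnS leq_eqVlt (negPf ne) /= -(ltn_pmul2r d0); lia.
have {e mE} mE : m + d = n.+1 by rewrite n1 mulSn; lia.
(* For a singleton parent, [m] = 0 and [n] = d - 1, but the pairs only start at d. *)
have [r1|r1] := eqVneq r 1.
  move: m_near Ln; rewrite r1 (layer_startS d (ltn0Sn 0)) bin1 /layer_start big_geq //.
  by rewrite !add0n => md; move: m0; rewrite modn_small //; lia.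
have := layer_startS d r0; have := layer_startS d (ltn0Sn r) => LS2 LS1.
(* For the full set, [n.+1] is 2 ^ d - 1, which d does not divide. *)
have [rd1|rd1] := eqVneq r.+1 d.
  have := ndvdn_exp2_subn1 d1; rewrite -sz szG subn1 /= => /negP[].
  suff -> : layer_start d d.+1 = n.+1 by rewrite n1 dvdn_mull.
  by move: LS2 Ln nL; rewrite rd1 binn; lia.
(* The parent being an interval, n < [layer_start d r] + 2d - 1, whereas layer [r] has at least 2d -
   1 sets. *)
have [d5|d4] := leqP 5 d.
  by have := bin_ge_double d5 (_ : 1 < r) (_ : r + 1 < d); lia.
(* Here the triples start at [n] = 10; ending a block, [n] is at least 11 and [m] at least 8, past
   the intervals of layer 2 at 4 to 7. *)
have {d4 rd rd1 r0 r1} [d4 r2] : d = 4 /\ r = 2 by lia.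
move: LS1 m_near Ln near last_mod n1.
rewrite d4 r2 (layer_startS 4 (ltn0Sn 0)).
have -> : layer_start 4 1 = 0 by rewrite /layer_start big_geq.
have -> : 'C(4, 1) = 4 by [].
have -> : 'C(4, 2) = 6 by [].
by move=> LS1 m_near Ln near last_mod n1; lia.
Qed.

Theorem theorem7p13 (d : nat) (hd : (2 <= d)%N) :
  [/\ (exists (delta : d.-tuple (vertex d)) (g : seq (vertex d)),
        regular_order delta g),
      (forall l : nat, (1 <= l <= d)%N ->
        min_broadcast_time d l (ceil_ratio (\sum_(1 <= i < l.+1) 'C(d, i)) d))
    & [/\ min_broadcast_time d d (ceil_ratio (2 ^ d - 1) d),
      min_exchange_time d [:: d - 1; d] d,
      (forall s : nat, (1 <= s < d - 1)%N ->
        min_exchange_time d [:: s] 'C(d - 1, s - 1))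
    & min_exchange_time d (iota 1 d) (2 ^ (d - 1))]].
Proof.
have d0 : 0 < d by apply: ltnW.
have [G oG] := layered_order_exists d0 hd.
split.
- by exists [tuple gen i | i < d], (map (@vec d) G); apply: layered_regular_order oG.
- by move=> l _; apply: layered_min_broadcast_time oG.
split.
- have -> : 2 ^ d - 1 = \sum_(1 <= i < d.+1) 'C(d, i).
    rewrite -sum_bin -(big_mkord xpredT (fun i => 'C(d, i))) big_ltn // bin0.
    by rewrite addKn.
  exact: layered_min_broadcast_time oG.
- apply: min_exchange_time_sum => //=; first by rewrite inE; lia.
  + by rewrite d0 !andbT subn_gt0.
  (* A direction lies in d - 1 sets of size d - 1 and in the full set. *)
  + case: d hd {d0 G oG} => [|[|d]] // _.
    by rewrite big_cons big_seq1 subn1 /= binSn binn addn1.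
- move=> s /andP[s0 sd]; rewrite !subn1; apply: min_exchange_time_sum => //=.
  + by rewrite bin_gt0; lia.
  + by rewrite s0.
  + by rewrite big_seq1.
  + move=> n; rewrite inE => /eqP-> _; have := @ltn_bin d.-1 s.-1; lia.
- apply: min_exchange_time_sum => //.
  + by rewrite expn_gt0.
  + exact: iota_uniq.
  + by apply/allP => n; rewrite mem_iota => /andP[].
  + have -> : iota 1 d = index_iota 1 d.+1 by rewrite /index_iota subn1.
    rewrite big_add1 big_mkord /= subn1; case: d d0 {hd G oG} => // d _.
    exact: sum_bin.
  + by move=> n _ /leq_trans; apply; have := ltn_expl (d - 1) (ltnSn 1); lia.
Qed.
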